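(* Let $p>3$ be a prime and let $j\in\{2,3,\ldots,p-1\}$. Define $$M_p(j)=\Big\{\, i\in\{1,2,\ldots,\tfrac{p-1}{2}\} \;:\; i<\{ij\}_p<\tfrac{p}{2}\Big\}.$$ Then $$|M_p(j)|\equiv \frac{\big(\frac{1-j}{p}\big)-1}{2}+\frac{p^2-1}{8}\pmod 2,$$ which amounts to: $\big(\frac{j-1}{p}\big)=(-1)^{|M_p(j)|}$ when $p\equiv 1,3\pmod 8$, and $\big(\frac{j-1}{p}\big)=(-1)^{|M_p(j)|+1}$ when $p\equiv 5,7\pmod 8$.
   Context: For an integer $x$, $\{x\}_p$ denotes the least nonnegative residue of $x$ modulo $p$. $\big(\frac{\cdot}{p}\big)$ is the Legendre symbol and $|A|$ is the cardinality of a set $A$. *)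

(* Defs.v *)
From mathcomp Require Import all_boot all_order all_algebra.

Set Implicit Arguments.
Unset Strict Implicit.
Unset Printing Implicit Defensive.

Import Order.TTheory GRing.Theory Num.Theory.

Local Open Scope ring_scope.

(* Legendre symbol (a / p), meaningful for p an odd prime. *)
Definition legendre (p : nat) (a : int) : int :=
  if (p%:Z %| a)%Z then 0
  else if [exists x : 'I_p, (x%:Z ^+ 2 == a %[mod p%:Z])%Z] then 1
  else -1.

(* The bound p / 2 is compared in rat, since p is odd. *)
Definition Mset (p j : nat) : {set 'I_p} :=
  [set i : 'I_p | [&& (1 <= i <= (p - 1) %/ 2)%N,
                      (i < (i * j) %% p)%N
                    & (((i * j) %% p)%N%:R < p%:R / 2%:R :> rat)]].

(* Main.v *)
(** Write p = 2h + 1.  Gauss's lemma expresses ((1 - j) / p) as the sign (-1)^N,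
    where N counts the i in [1, h] with {i(1 - j)}_p > h.  For i in [1, h] let s
    and t be the absolute least residues of ij and i(1 - j).  Since i is
    congruent to ij + i(1 - j), the parity of i + s + t is that of
    [i in M_p(j)] + [{i(1 - j)}_p > h].  Both s and t run through 1, ..., h when
    i does, so summing over i gives 3(1 + ... + h) = |M_p(j)| + N modulo 2, and
    1 + ... + h = (p^2 - 1) / 8. *)

Require Import Defs.
From mathcomp Require Import all_boot all_order all_algebra all_field.
From mathcomp Require Import zify ring.

Set Implicit Arguments.
Unset Strict Implicit.
Unset Printing Implicit Defensive.

Import Order.TTheory GRing.Theory Num.Theory.

Local Open Scope ring_scope.

(** Unsigned: the sign of the absolute least residue is kept apart, as the truth value of
    [p./2 < x %% p]. *)
Definition absres (p x : nat) : nat := minn (x %% p) (p - x %% p).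

(** Equal absolute residues mean a i = a k or a i = - a k modulo p, so p divides i - k or i + k. The
    range forces i = k in the first case, and i = k = [p./2] in the second. *)
Lemma absres_mul_inj (p a : nat) : prime p -> ~~ (p %| a)%N ->
  {in index_iota 1 p./2.+1 &, injective (fun i => absres p (a * i))}.
Proof.
move=> pp na i k; rewrite !mem_index_iota => Hi Hk E.
have ca : coprime p a by rewrite prime_coprime.
have p0 := prime_gt0 pp.
have [Eq|Ad] : (a * i = a * k %[mod p])%N \/ (p %| a * i + a * k)%N.
- have mi := ltn_pmod (a * i) p0; have mk := ltn_pmod (a * k) p0.
  rewrite /absres in E.
  have [->|Es] : (a * i %% p = a * k %% p)%N \/ (a * i %% p + a * k %% p = p)%N by lia.
    by left.
  by right; rewrite /dvdn -modnDm Es modnn.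
- wlog le_ik : i k Hi Hk {E} Eq / (i <= k)%N => [W|].
    case: (leqP i k) => [|/ltnW] le; first exact: W.
    by apply/esym/W.
  have : (p %| a * k - a * i)%N by rewrite -eqn_mod_dvd ?leq_mul2l ?le_ik ?orbT // Eq.
  rewrite -mulnBr Gauss_dvdr // => /dvdn_leq H.
  by case: (posnP (k - i)) => [|/H]; lia.
- by move: Ad; rewrite -mulnDr Gauss_dvdr // => /dvdn_leq H; lia.
Qed.

(** An injective map of a finite interval into itself permutes it. This reindexes both the product
    in Gauss's lemma and the sums of absolute residues. *)
Lemma perm_absres_mul (p a : nat) : prime p -> ~~ (p %| a)%N ->
  perm_eq [seq absres p (a * i) | i <- index_iota 1 p./2.+1]
          (index_iota 1 p./2.+1).
Proof.
move=> pp na; have p0 := prime_gt0 pp.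
have U : uniq [seq absres p (a * i) | i <- index_iota 1 p./2.+1].
  by rewrite map_inj_in_uniq ?iota_uniq //; exact: absres_mul_inj.
apply: uniq_perm; rewrite ?iota_uniq //.
apply: (uniq_min_size U _ _).2; last by rewrite size_map.
move=> _ /mapP[i Hi ->]; move: Hi; rewrite !mem_index_iota => Hi.
have : (0 < (a * i) %% p)%N.
  rewrite lt0n; apply/negP => H; move: (H : (p %| a * i)%N).
  by rewrite Euclid_dvdM // (negbTE na) /= => /dvdn_leq; lia.
have := ltn_pmod (a * i) p0; rewrite /absres; lia.
Qed.

Lemma natr_absres (p x : nat) : prime p ->
  x%:R = (-1) ^+ (p./2 < x %% p)%N * (absres p x)%:R :> 'F_p.
Proof.
move=> pp; have := ltn_pmod x (prime_gt0 pp) => Hp.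
rewrite -(GRing.natr_mod_pchar (pchar_Fp pp) x) /absres.
case: (ltnP p./2) => Hx /=; last by rewrite expr0 mul1r; congr _%:R; lia.
have -> : minn (x %% p) (p - x %% p) = (p - x %% p)%N by lia.
by rewrite natrB ?(ltnW Hp) // pchar_Fp_0 // sub0r expr1 mulN1r opprK.
Qed.

Lemma natr_Fp_eq0 (p n : nat) : prime p -> (n%:R == 0 :> 'F_p) = (p %| n)%N.
Proof. by move=> pp; rewrite (dvdn_pcharf (pchar_Fp pp)). Qed.

(** The product of the a i is computed in two ways, by extracting either the powers of a or the
    signs. Both leave the factor [P], which is h! and invertible modulo p. *)
Lemma gauss_lemma (p a : nat) : prime p -> ~~ (p %| a)%N ->
  a%:R ^+ p./2 =
  (-1) ^+ (\sum_(1 <= i < p./2.+1) (p./2 < (a * i) %% p))%N :> 'F_p.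
Proof.
move=> pp na; pose P : 'F_p := \prod_(1 <= i < p./2.+1) i%:R.
have P0 : P != 0.
  rewrite prodf_seq_neq0; apply/allP => i; rewrite mem_index_iota => Hi /=.
  by rewrite natr_Fp_eq0 //; apply/negP => /dvdn_leq; lia.
apply: (mulIf P0).
transitivity (\prod_(1 <= i < p./2.+1) (a * i)%:R : 'F_p).
  under [RHS]eq_bigr do rewrite natrM.
  by rewrite big_split /= prodr_const_nat subSS subn0.
under eq_bigr do rewrite (natr_absres _ pp).
rewrite big_split /= expr_sum; congr (_ * _).
by rewrite /P -[in RHS](perm_big _ (perm_absres_mul pp na)) big_map.
Qed.

(* A nonsquare a with a^h = 1 would give 'X^h - 1 the h + 1 distinct roots a,
   1^2, ..., h^2. *)
Lemma euler_criterion (p : nat) (a : int) : prime p -> odd p ->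
  ~~ (p%:Z %| a)%Z -> (legendre p a)%:~R = a%:~R ^+ p./2 :> 'F_p.
Proof.
move=> pp op; have chp := pchar_Fp pp.
have ph : (0 < p./2)%N by have := prime_gt1 pp; lia.
have expp (y : 'F_p) : y != 0 -> (y ^+ 2) ^+ p./2 = 1.
  move=> y0; apply: (mulfI y0); rewrite mulr1 -exprM -exprS.
  have -> : (2 * p./2).+1 = p by lia.
  by rewrite -{2}(expf_card y) card_Fp.
rewrite /legendre => na; rewrite (negbTE na).
have a0 : a%:~R != 0 :> 'F_p by rewrite -(dvdz_pcharf chp).
case: ifP => [/existsP[x]|/existsP Nx].
  rewrite eqz_mod_dvd (dvdz_pcharf chp) rmorphB rmorphXn /= subr_eq0 => /eqP E.
  rewrite -E expp //; apply: contraNneq a0 => x0.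
  by rewrite -E x0 expr0n.
have Nsq (x : nat) : (x%:R ^+ 2 != a%:~R :> 'F_p).
  apply/eqP => E; apply: Nx.
  exists (Ordinal (ltn_pmod x (prime_gt0 pp))).
  rewrite eqz_mod_dvd (dvdz_pcharf chp) rmorphB rmorphXn /= subr_eq0.
  by rewrite -E -pmulrn GRing.natr_mod_pchar.
(* By Fermat a^h is 1 or -1; for a nonsquare, only the value 1 remains to be refuted. *)
have : (a%:~R ^+ p./2) ^+ 2 == 1 :> 'F_p by rewrite exprAC expp.
rewrite sqrf_eq1 => /orP[|/eqP->//] /eqP E.
pose s : seq 'F_p := [seq i%:R ^+ 2 | i <- index_iota 1 p./2.+1].
have Us : uniq (a%:~R :: s).
  rewrite cons_uniq; apply/andP; split.
    by apply/mapP => -[i _ Ei]; move: (Nsq i); rewrite Ei eqxx.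
  rewrite map_inj_in_uniq ?iota_uniq // => i k.
  rewrite !mem_index_iota => Hi Hk /eqP.
  rewrite eqf_sqr -addr_eq0 -natrD natr_Fp_eq0 //.
  case/orP => [|/dvdn_leq]; last by lia.
  wlog le_ik : i k Hi Hk / (i <= k)%N => [W|].
    case: (leqP i k) => [|/ltnW] le; first exact: W.
    by rewrite eq_sym => /(W _ _ Hk Hi le).
  rewrite eq_sym -subr_eq0 -natrB // natr_Fp_eq0 // => /dvdn_leq H.
  by case: (posnP (k - i)) => [|/H]; lia.
have Rs : all (root ('X^(p./2) - 1)) (a%:~R :: s).
  apply/allP => x; rewrite in_cons => /predU1P[->|/mapP[i Hi ->]].
    by rewrite rootE !hornerE E subrr.
  rewrite rootE !hornerE expp ?subrr // natr_Fp_eq0 //.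
  by move: Hi; rewrite mem_index_iota => Hi; apply/negP => /dvdn_leq; lia.
have := max_poly_roots _ Rs Us.
rewrite size_Xn_sub_1 //= size_map size_iota -size_poly_eq0 size_Xn_sub_1 //.
by rewrite subSS subn0 ltnn => /(_ isT).
Qed.

(** Lifts a sign from ['F_p] to the integers, which is sound because 1 and -1 differ modulo an odd
    p. *)
Lemma legendre_sign (p n : nat) (a : int) : prime p -> odd p ->
  ~~ (p%:Z %| a)%Z -> a%:~R ^+ p./2 = (-1) ^+ n :> 'F_p ->
  legendre p a = (-1) ^+ n.
Proof.
move=> pp op na; rewrite -euler_criterion //.
have two0 : 2%:R != 0 :> 'F_p.
  by rewrite natr_Fp_eq0 // dvdn_prime2 //; apply: contraTneq op => ->.
rewrite -(signr_odd int n) -(signr_odd 'F_p n).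
have N11 : (1 == -1 :> 'F_p) = false.
  by rewrite -subr_eq0 opprK -(natrD _ 1 1) (negbTE two0).
rewrite /legendre (negbTE na); case: ifP => _; case: (odd n) => //= /eqP.
  by rewrite expr1 N11.
by rewrite expr0 eq_sym N11.
Qed.

(* Here r and u stand for the residues of ij and i(1 - j). *)
Lemma odd_absres_sum (p i r u : nat) : odd p -> (0 < i <= p./2)%N ->
  (r < p)%N -> (u < p)%N -> (r != 0)%N -> (u + r == i %[mod p])%N ->
  odd (i + minn r (p - r) + minn u (p - u)) =
  (i < r <= p./2)%N (+) (p./2 < u)%N.
Proof.
move=> op Hi Hr Hu r0 E.
have [S|S] : (u + r = i \/ u + r = i + p)%N.
  move: E; rewrite (modn_small (m := i)); last by lia.
  case: (ltnP (u + r) p) => H; first by rewrite modn_small // => /eqP; left.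
  have -> : (u + r = (u + r - p) + p)%N by lia.
  by rewrite modnDr modn_small => [/eqP|]; lia.
(* If u + r = i, the sum on the left is 2i. If u + r = i + p, then i < r, and the sum is 2r when r
   <= h, 2u when u <= h, and p when both exceed h. *)
- lia.
- lia.
Qed.

(** For odd p, a natural number lies below the rational p/2 exactly when it is at most [p./2]. *)
Lemma card_Mset (p j : nat) : odd p ->
  #|Mset p j| = (\sum_(1 <= i < p./2.+1) (i < (i * j) %% p <= p./2))%N.
Proof.
move=> op; pose F i := nat_of_bool [&& 0 < i <= p./2 & i < (i * j) %% p <= p./2]%N.
transitivity (\sum_(0 <= i < p) F i)%N.
  rewrite -sum1_card big_mkcond big_mkord; apply: eq_bigr => i _.
  rewrite inE /F ltr_pdivlMr // -natrM ltr_nat.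
  by congr (nat_of_bool _); lia.
rewrite (big_cat_nat (n := p./2.+1)) //=; last by lia.
rewrite [X in (_ + X)%N]big_nat_cond [X in (_ + X)%N]big1 => [|i]; last first.
  by rewrite /F; lia.
rewrite addn0 big_ltn // add0n; apply: eq_big_nat => i Hi.
by rewrite /F; congr (nat_of_bool _); lia.
Qed.

(** Here [p.+1 - j] is a natural representative of 1 - j. The three sums of i, s and t are all equal
    to ['C(p./2.+1, 2)], so modulo 2 they leave one copy of it. *)
Lemma odd_card_Mset (p j : nat) : prime p -> odd p -> (1 < j < p)%N ->
  odd #|Mset p j| =
  odd (\sum_(1 <= i < p./2.+1) (p./2 < ((p.+1 - j) * i) %% p))%N
  (+) odd 'C(p./2.+1, 2).
Proof.
move=> pp op Hj; have p0 := prime_gt0 pp.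
have nj : ~~ (p %| j)%N by apply/negP => /dvdn_leq; lia.
have nb : ~~ (p %| p.+1 - j)%N by apply/negP => /dvdn_leq; lia.
have oddS (F : nat -> nat) : odd (\sum_(1 <= i < p./2.+1) F i)%N =
    \big[addb/false]_(1 <= i < p./2.+1) odd (F i).
  exact: (big_morph odd oddD (erefl : odd 0 = false)).
have S1 : (\sum_(1 <= i < p./2.+1) i)%N = 'C(p./2.+1, 2).
  by rewrite -bin2_sum [in RHS]big_ltn.
have S a : ~~ (p %| a)%N ->
    (\sum_(1 <= i < p./2.+1) absres p (a * i))%N = 'C(p./2.+1, 2).
  by move=> na; rewrite -S1 -[RHS](perm_big _ (perm_absres_mul pp na)) big_map.
have := oddS (fun i => i + absres p (j * i) + absres p ((p.+1 - j) * i))%N.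
rewrite !big_split /= !S // S1.
rewrite (eq_big_nat _ _ (F2 := fun i => odd (i < (i * j) %% p <= p./2)%N (+)
    odd (p./2 < ((p.+1 - j) * i) %% p)%N)) => [|i Hi]; last first.
  rewrite !oddb (mulnC i j); apply: odd_absres_sum; rewrite ?ltn_pmod //.
    apply/negP => H; move: (H : (p %| j * i)%N).
    by rewrite Euclid_dvdM // (negbTE nj) /= => /dvdn_leq; lia.
  rewrite modnDm -mulnDl; have -> : (p.+1 - j + j = p + 1)%N by lia.
  by rewrite mulnDl mul1n mulnC modnMDl.
rewrite big_split /= -!oddS -card_Mset //; move: 'C(_, _) => C.
by rewrite !oddD; case: (odd C); case: (odd #|_|); case: odd.
Qed.

(** Writing h = 4q + r, the number h(h + 1)/2 has the parity of r(r + 1)/2, which is 0, 1, 3 or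
    6. *)
Lemma odd_binS2 (h : nat) :
  odd 'C(h.+1, 2) = ((h %% 4 == 1) || (h %% 4 == 2))%N.
Proof.
have := mul_bin_diag h.+1 1; rewrite bin1 /=.
have := divn_eq h 4; have : (h %% 4 < 4)%N by rewrite ltn_pmod.
move: (h %/ 4)%N (h %% 4)%N => q r Hr -> E.
have : (((q * 4 + r).+1 * (q * 4 + r)) = 8 * (2 * (q * q) + q * r) + 4 * q + r * r + r)%N.
  by ring.
by move: r Hr E => [|[|[|[|//]]]] _ ->; lia.
Qed.

(** The division is exact: p = 2h + 1 gives p^2 - 1 = 4h(h + 1). *)
Lemma sqr_pred_div8 (p : nat) : odd p ->
  ((p%:Z ^+ 2 - 1) %/ 8)%Z = 'C(p./2.+1, 2)%:Z.
Proof.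
move=> op; have := mul_bin_diag p./2.+1 1; rewrite bin1 [_.-1]/=.
have {op} : p = (2 * p./2 + 1)%N by lia.
move: p./2 'C(_, _) => h C -> E.
have -> : (2 * h + 1)%N%:Z ^+ 2 - 1 = (h.+1 * h)%N%:Z * 4.
  by rewrite -[h.+1]addn1 (PoszM (h + 1)) !PoszD; ring.
by rewrite E PoszM mulrAC mulrC mulzK.
Qed.

Theorem theorem2p1 (p j : nat) (p_prime : prime p) (p_gt3 : (3 < p)%N)
    (j_range : (2 <= j <= p - 1)%N) :
  [/\ (#|Mset p j|%:Z = ((legendre p (1 - j%:Z) - 1) %/ 2)%Z
                        + ((p%:Z ^+ 2 - 1) %/ 8)%Z %[mod 2])%Z,
      ((p = 1 %[mod 8])%N \/ (p = 3 %[mod 8])%N ->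
         legendre p (j%:Z - 1) = (-1) ^+ #|Mset p j|)
    & ((p = 5 %[mod 8])%N \/ (p = 7 %[mod 8])%N ->
         legendre p (j%:Z - 1) = (-1) ^+ (#|Mset p j| + 1)%N)].
Proof.
have op : odd p by case: (even_prime p_prime) => // p2; move: p_gt3; rewrite p2.
have nb : ~~ (p %| p.+1 - j)%N by apply/negP => /dvdn_leq; lia.
have Hj : (1 < j < p)%N by lia.
have OM := odd_card_Mset p_prime op Hj.
have Eb : (p.+1 - j)%:R = (1 - j%:Z)%:~R :> 'F_p.
  by rewrite natrB; [rewrite -(addn1 p) natrD pchar_Fp_0 // add0r rmorphB | lia].
have nd : ~~ (p%:Z %| 1 - j%:Z)%Z.
  by rewrite (dvdz_pcharf (pchar_Fp p_prime)) -Eb natr_Fp_eq0.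
have nd' : ~~ (p%:Z %| j%:Z - 1)%Z by rewrite -opprB rpredN.
have G := gauss_lemma p_prime nb; rewrite Eb in G.
move: (\sum_(1 <= i < _) _)%N OM G => N OM G.
have L1 := legendre_sign p_prime op nd G.
(* The additional exponent h is the contribution of -1, since j - 1 = -(1 - j). *)
have L2 : legendre p (j%:Z - 1) = (-1) ^+ (p./2 + N).
  apply: legendre_sign => //.
  by rewrite -opprB rmorphN /= (exprNn (1 - j%:Z)%:~R) G exprD.
have OB := odd_binS2 p./2.
split.
(* The quotient ((-1)^N - 1)/2 is 0 or -1, hence congruent to N modulo 2. *)
- rewrite L1 -signr_odd sqr_pred_div8 //.
  move: 'C(_, _) OM {OB} => C; clear.
  by case: (odd N) => OM; rewrite ?expr0 ?expr1; lia.
(* It remains to compare the parities of h and h(h + 1)/2: they agree for h = 0, 1 modulo 4, that is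
   p = 1, 3 modulo 8, and differ otherwise. *)
- move=> H; rewrite L2 -(signr_odd int (_ + _)) -(signr_odd int #|_|) oddD OM OB.
  by congr (_ ^+ nat_of_bool _); clear -H op; lia.
- move=> H; rewrite L2 -(signr_odd int (_ + N)) -(signr_odd int (_ + 1)).
  rewrite !oddD OM OB.
  by congr (_ ^+ nat_of_bool _); clear -H op; lia.
Qed.
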